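(* Let $n \ge 4$ be an integer and let $p/q$ and $r/s$ be Farey neighbors of order $n$, with $q < s$, such that $\lfloor n/q \rfloor = 1$ and \[ 0 < \min\left\{ \frac{p}{q}, \frac{r}{s} \right\} < \max\left\{ \frac{p}{q}, \frac{r}{s} \right\} < \frac{1}{2}. \] Then the K-arc $K_n\left( \min\left\{ \frac{p}{q}, \frac{r}{s} \right\}, \max\left\{ \frac{p}{q}, \frac{r}{s} \right\} \right)$ is simple; that is, if $\lambda : [0,1] \to \mathbb{C}$ is a continuous function defining this K-arc, then $\lambda(\alpha) \neq \lambda(\hat\alpha)$ whenever $\alpha, \hat\alpha \in [0,1]$ and $\alpha \ne \hat\alpha$.
   Context: For $k \in \mathbb{N}$, $\omega_k = \cos(2\pi/k) + i \sin(2\pi/k)$. For a nonzero complex number $z$, $\operatorname{Arg} z$ is the argument of $z$ lying in $(-\pi,\pi]$. The Farey fractions of order $n$ are the elements of $F_n = \{ p/q : 0 \le p \le q \le n,\ \gcd(p,q) = 1 \}$ (always written in lowest terms $p/q$). Two elements $x<y$ of $F_n$ form a Farey pair $(x,y)$ of order $n$ if no element of $F_n$ lies strictly between $x$ and $y$; two Farey fractions $p/q$ and $r/s$ are Farey neighbors of order $n$ if $(p/q, r/s)$ or $(r/s, p/q)$ is a Farey pair of order $n$. When $\lfloor n/q \rfloor = 1$, the relevant (Type I reduced Ito) polynomial is $P_\alpha(t) = t^s - (1-\alpha) t^{s-q} - \alpha$, $\alpha \in [0,1]$. A continuous function $\lambda : [0,1] \to \mathbb{C}$ defines the K-arc with respect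 to $p/q$ and $r/s$ (of order $n$) if $\lambda(0) = \omega_q^p$, $\lambda(1) = \omega_s^r$, $P_\alpha(\lambda(\alpha)) = 0$ for all $\alpha \in [0,1]$, and \[ \min\left\{ \frac{p}{q}, \frac{r}{s} \right\} \le \frac{\operatorname{Arg} \lambda(\alpha)}{2\pi} \le \max\left\{ \frac{p}{q}, \frac{r}{s} \right\} \quad \text{for all } \alpha \in [0,1]; \] the K-arc $K_n\left( \min\left\{ \frac{p}{q}, \frac{r}{s} \right\}, \max\left\{ \frac{p}{q}, \frac{r}{s} \right\} \right)$ is then the set $\{ \lambda(\alpha) : \alpha \in [0,1] \}$. *)

(* Defs.v *)
From Stdlib Require Import Reals Lra Lia Psatz Arith.
From Coquelicot Require Import Coquelicot.

Open Scope R_scope.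

(** The pairs [(p, q)] that write an element of [F_n] in lowest terms;
    [q = 0] is excluded by [p <= q] and [Nat.gcd p q = 1]. *)
Definition farey_fraction (n p q : nat) : Prop :=
  (p <= q)%nat /\ (q <= n)%nat /\ Nat.gcd p q = 1%nat.

Definition farey (n : nat) (x : R) : Prop :=
  exists p q : nat, farey_fraction n p q /\ x = INR p / INR q.

Definition farey_pair (n : nat) (x y : R) : Prop :=
  farey n x /\ farey n y /\ x < y /\
  ~ (exists z : R, farey n z /\ x < z < y).

Definition farey_neighbors (n p q r s : nat) : Prop :=
  farey_fraction n p q /\ farey_fraction n r s /\
  (farey_pair n (INR p / INR q) (INR r / INR s) \/
   farey_pair n (INR r / INR s) (INR p / INR q)).

Definition omega (k : nat) : C :=
  (cos (2 * PI / INR k), sin (2 * PI / INR k)).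

Definition is_principal_arg (z : C) (theta : R) : Prop :=
  - PI < theta <= PI /\
  z = (Cmod z * cos theta, Cmod z * sin theta).

(** Meaningful for [z <> 0] only, see [Arg_correct]. *)
Definition Arg (z : C) : R := iota (is_principal_arg z).

(** The case [n / q = 1] of the Type I reduced Ito polynomial. For [q < s] the
    natural-number subtraction [s - q] is the usual one. *)
Definition ito_poly (q s : nat) (alpha : R) (t : C) : C :=
  (t ^ s - (1 - RtoC alpha) * t ^ (s - q) - RtoC alpha)%C.

(** Only the values of [lambda] on the interval from 0 to 1 are constrained;
    [continuous_on] is continuity of the restriction to that interval. *)
Definition defines_K_arc (p q r s : nat) (lambda : R -> C) : Prop :=
  continuous_on (fun alpha => 0 <= alpha <= 1) lambda /\
  lambda 0 = (omega q ^ p)%C /\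
  lambda 1 = (omega s ^ r)%C /\
  (forall alpha : R, 0 <= alpha <= 1 ->
     ito_poly q s alpha (lambda alpha) = RtoC 0) /\
  (forall alpha : R, 0 <= alpha <= 1 ->
     Rmin (INR p / INR q) (INR r / INR s)
       <= Arg (lambda alpha) / (2 * PI)
       <= Rmax (INR p / INR q) (INR r / INR s)).

Lemma principal_arg_exists (z : C) :
  z <> RtoC 0 -> exists theta : R, is_principal_arg z theta.
Proof.
intros Hz.
assert (Hm : 0 < Cmod z) by now apply Cmod_gt_0.
assert (Hsq : Cmod z * Cmod z = fst z * fst z + snd z * snd z).
{ unfold Cmod; rewrite sqrt_sqrt; [ring | nra]. }
set (x := fst z / Cmod z); set (y := snd z / Cmod z).
assert (Hxy : x * x + y * y = 1).
{ unfold x, y.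
  replace (fst z / Cmod z * (fst z / Cmod z) + snd z / Cmod z * (snd z / Cmod z))
    with ((fst z * fst z + snd z * snd z) / (Cmod z * Cmod z)) by (field; lra).
  rewrite <- Hsq; field; lra. }
assert (Hx : -1 <= x <= 1) by (split; nra).
assert (Hfst : fst z = Cmod z * x) by (unfold x; field; lra).
assert (Hsnd : snd z = Cmod z * y) by (unfold y; field; lra).
assert (Hy : sqrt (1 - Rsqr x) = Rabs y).
{ rewrite <- sqrt_Rsqr_abs; f_equal; unfold Rsqr; lra. }
pose proof (acos_bound x) as Hb; pose proof PI_RGT_0 as HPI.
destruct (Rle_dec 0 y) as [Hy0 | Hy0].
- exists (acos x); split; [lra |].
  rewrite cos_acos, sin_acos, Hy, Rabs_right, <- Hfst, <- Hsnd by lra.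
  now destruct z.
- exists (- acos x).
  assert (Hne : acos x <> PI).
  { intros E.
    assert (Hx1 : x = -1) by (rewrite <- (cos_acos x Hx), E; apply cos_PI).
    nra. }
  split; [lra |].
  rewrite cos_neg, sin_neg, cos_acos, sin_acos, Hy, Rabs_left by lra.
  rewrite Ropp_involutive, <- Hfst, <- Hsnd.
  now destruct z.
Qed.

Lemma principal_arg_unique (z : C) (a b : R) :
  z <> RtoC 0 -> is_principal_arg z a -> is_principal_arg z b -> a = b.
Proof.
intros Hz [Ha Ea] [Hb Eb].
assert (Hm : 0 < Cmod z) by now apply Cmod_gt_0.
rewrite Ea in Eb at 1; injection Eb as Ec Es.
apply Rmult_eq_reg_l in Ec; [| lra].
apply Rmult_eq_reg_l in Es; [| lra].
assert (Hs : sin ((a - b) / 2) = 0).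
{ assert (H1 : cos (a - b) = 1).
  { rewrite cos_minus, Ec, Es.
    pose proof (sin2_cos2 b) as H; unfold Rsqr in H; lra. }
  replace (a - b) with (2 * ((a - b) / 2)) in H1 by field.
  rewrite cos_2a_sin in H1; nra. }
destruct (Rtotal_order a b) as [H | [H | H]]; [| exact H |].
- assert (H1 : 0 < sin (- ((a - b) / 2))) by (apply sin_gt_0; lra).
  rewrite sin_neg in H1; lra.
- assert (H1 : 0 < sin ((a - b) / 2)) by (apply sin_gt_0; lra).
  lra.
Qed.

Lemma Arg_correct (z : C) : z <> RtoC 0 -> is_principal_arg z (Arg z).
Proof.
intros Hz; apply (iota_correct (V := R_CompleteNormedModule) (is_principal_arg z)).
destruct (principal_arg_exists z Hz) as [t Ht].
exists t; split; [exact Ht |].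
intros t' Ht'; now apply (principal_arg_unique z).
Qed.

(* Main.v *)
Require Import Defs.
From Stdlib Require Import Reals Lra Lia ZArith.
From Coquelicot Require Import Coquelicot.
Open Scope R_scope.

(** [P_alpha(t)] is affine in [alpha] with slope [t^(s-q) - 1], so a point taken
    at two parameters is a root of unity of order dividing [s - q], and its
    argument over [2 pi] is a fraction [k / (s - q)].  Since [n / q = 1] forces
    [s <= n < 2 q], this denominator is smaller than [q] and [s].  The fraction
    is thus a Farey fraction of order [n] other than both neighbors, and it
    cannot lie between them. *)

Lemma Cpow_polar (m theta : R) (d : nat) :
  Cpow (m * cos theta, m * sin theta) d
  = (m ^ d * cos (INR d * theta), m ^ d * sin (INR d * theta)).
Proof.
induction d as [| d IH].
- simpl; rewrite Rmult_0_l, cos_0, sin_0; unfold RtoC; f_equal; ring.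
- rewrite Cpow_S, IH, S_INR.
  replace ((INR d + 1) * theta) with (theta + INR d * theta) by ring.
  rewrite cos_plus, sin_plus.
  unfold Cmult; simpl; f_equal; ring.
Qed.

(** By de Moivre's formula, [z ^ d = 1] makes [d * Arg z] an integer multiple of [2 * PI]. The
    numerator lies in [Z] because [Arg] may be negative. *)
Lemma root_of_unity_Arg (d : nat) (z : C) :
  (0 < d)%nat -> (z ^ d)%C = RtoC 1 ->
  exists k : Z, Arg z / (2 * PI) = IZR k / INR d.
Proof.
intros Hd Hz.
assert (Hz0 : z <> RtoC 0).
{ intros E; subst z; destruct d as [| d]; [lia |].
  simpl in Hz; rewrite Cmult_0_l in Hz; injection Hz; lra. }
destruct (Arg_correct z Hz0) as [_ E].
set (theta := Arg z) in *.
rewrite E, Cpow_polar in Hz.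
injection Hz as Hc Hs.
set (x := INR d * theta) in *.
assert (HM : 0 <= Cmod z ^ d) by apply pow_le, Cmod_ge_0.
pose proof (sin2_cos2 x) as Hsc; unfold Rsqr in Hsc.
set (M := Cmod z ^ d) in *.
(* The squares of the real and imaginary parts add up to [M * M = 1], and [M] is nonnegative. *)
assert (HM1 : M = 1).
{ assert (M * M = 1).
  { replace (M * M) with ((M * sin x) * (M * sin x) + (M * cos x) * (M * cos x));
      [rewrite Hc, Hs; ring |].
    transitivity (M * M * (sin x * sin x + cos x * cos x)); [ring |].
    rewrite Hsc; ring. }
  nra. }
rewrite HM1, Rmult_1_l in Hc.
(* The half angle is used because [sin x = 0] alone would only give a multiple of [PI]. *)
assert (Hh : sin (x / 2) = 0).
{ replace x with (2 * (x / 2)) in Hc by field.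
  rewrite cos_2a_sin in Hc; nra. }
destruct (sin_eq_0_0 _ Hh) as [k Hk].
exists k.
pose proof PI_RGT_0; pose proof (lt_0_INR d Hd).
apply (Rmult_eq_reg_r (2 * PI * INR d)); [| nra].
replace (theta / (2 * PI) * (2 * PI * INR d)) with x by (unfold x; field; lra).
replace (IZR k / INR d * (2 * PI * INR d)) with (2 * (IZR k * PI)) by (field; lra).
lra.
Qed.

Lemma farey_div (n k d : nat) :
  (0 < d)%nat -> (k <= d)%nat -> (d <= n)%nat -> farey n (INR k / INR d).
Proof.
intros Hd Hkd Hdn.
destruct (Nat.gcd_divide k d) as [[a Ha] [b Hb]].
assert (Hg : Nat.gcd k d <> 0%nat) by (intros E; apply Nat.gcd_eq_0 in E; lia).
assert (Hab : Nat.gcd a b = 1%nat).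
{ pose proof (Nat.gcd_mul_mono_r a b (Nat.gcd k d)) as H.
  rewrite <- Ha, <- Hb in H; nia. }
set (g := Nat.gcd k d) in *; clearbody g.
exists a, b; split; [repeat split; nia |].
rewrite Ha, Hb, !mult_INR; field.
split; apply not_0_INR; nia.
Qed.

(** Cross-multiplying gives [p * d = q * k]; as [q] is coprime to [p], Gauss's lemma makes [q]
    divide the smaller positive number [d]. *)
Lemma farey_fraction_lowest (n p q k d : nat) :
  farey_fraction n p q -> (0 < d < q)%nat -> INR k / INR d <> INR p / INR q.
Proof.
intros (_ & _ & Hpq) Hd E.
assert (H : (p * d = q * k)%nat).
{ apply INR_eq; rewrite !mult_INR.
  assert (0 < INR d) by (apply lt_0_INR; lia).
  assert (0 < INR q) by (apply lt_0_INR; lia).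
  replace (INR p) with (INR p / INR q * INR q) by (field; lra).
  rewrite <- E; field; lra. }
assert (Hdiv : Nat.divide q d).
{ apply (Nat.gauss q p d); [exists k; lia | now rewrite Nat.gcd_comm]. }
apply Nat.divide_pos_le in Hdiv; lia.
Qed.

Lemma farey_pair_no_small_denominator (n p q r s k d : nat) :
  farey_fraction n p q -> farey_fraction n r s ->
  farey_pair n (INR p / INR q) (INR r / INR s) ->
  (0 < d)%nat -> (d < q)%nat -> (d < s)%nat -> (k <= d)%nat ->
  ~ (INR p / INR q <= INR k / INR d <= INR r / INR s).
Proof.
intros Hp Hr (_ & _ & _ & Hno) Hd Hq Hs Hk Hb.
apply Hno; exists (INR k / INR d); split.
- apply farey_div; try lia. destruct Hp as (_ & ? & _); lia.
- pose proof (farey_fraction_lowest n p q k d Hp (conj Hd Hq)).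
  pose proof (farey_fraction_lowest n r s k d Hr (conj Hd Hs)).
  lra.
Qed.

(** Subtracting the two equations cancels [t ^ s] and leaves [(a - b) * (t ^ (s - q) - 1) = 0]. *)
Lemma ito_poly_common_root (q s : nat) (a b : R) (t : C) :
  a <> b -> ito_poly q s a t = RtoC 0 -> ito_poly q s b t = RtoC 0 ->
  (t ^ (s - q))%C = RtoC 1.
Proof.
intros Hab Ha Hb; unfold ito_poly in *.
set (u := (t ^ (s - q))%C) in *; set (v := (t ^ s)%C) in *.
assert (H : ((RtoC a - RtoC b) * (u - 1))%C = RtoC 0).
{ transitivity ((v - (1 - RtoC a) * u - RtoC a)
                - (v - (1 - RtoC b) * u - RtoC b))%C; [ring |].
  rewrite Ha, Hb; ring. }
assert (Hc : (RtoC a - RtoC b)%C <> RtoC 0).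
{ rewrite <- RtoC_minus; intros E; apply RtoC_inj in E; lra. }
replace u with (/ (RtoC a - RtoC b) * ((RtoC a - RtoC b) * (u - 1)) + 1)%C
  by (field; exact Hc).
rewrite H; ring.
Qed.

Theorem theorem4p8 :
  forall n p q r s : nat,
  (4 <= n)%nat ->
  farey_neighbors n p q r s ->
  (q < s)%nat ->
  (n / q)%nat = 1%nat ->
  0 < Rmin (INR p / INR q) (INR r / INR s) ->
  Rmin (INR p / INR q) (INR r / INR s) < Rmax (INR p / INR q) (INR r / INR s) ->
  Rmax (INR p / INR q) (INR r / INR s) < 1 / 2 ->
  forall lambda : R -> C,
  defines_K_arc p q r s lambda ->
  forall alpha alpha' : R,
  0 <= alpha <= 1 -> 0 <= alpha' <= 1 -> alpha <> alpha' ->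
  lambda alpha <> lambda alpha'.
Proof.
intros n p q r s _ (Hpq & Hrs & Hpair) Hqs Hnq Hmin _ Hmax lambda
  (_ & _ & _ & Hroot & Harg) a b Ha Hb Hab E.
assert (Hsn : (s <= n)%nat) by apply Hrs.
assert (Hq0 : q <> 0%nat) by (intros ->; discriminate Hnq).
(* With quotient 1, [n] is [q] plus a remainder below [q]. *)
assert (Hn2q : (n < 2 * q)%nat).
{ pose proof (Nat.div_mod_eq n q); pose proof (Nat.mod_upper_bound n q Hq0); nia. }
pose proof (Hroot b Hb) as Hrb; rewrite <- E in Hrb.
pose proof (ito_poly_common_root q s a b _ Hab (Hroot a Ha) Hrb) as H1.
assert (Hd : (0 < s - q)%nat) by lia.
assert (Hdq : (s - q < q)%nat) by lia.
destruct (root_of_unity_Arg (s - q) _ Hd H1) as [z Hz].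
pose proof (Harg a Ha) as Hbd; rewrite Hz in Hbd.
set (d := (s - q)%nat) in *.
assert (Hd0 : 0 < INR d) by now apply lt_0_INR.
assert (Hzd : IZR z / INR d * INR d = IZR z) by (field; lra).
(* The arc lies above the positive bound [Hmin], so the numerator can be taken in [nat]. *)
assert (Hz0 : (0 <= z)%Z) by (apply le_IZR; nra).
assert (Hk : IZR z = INR (Z.to_nat z)) by (rewrite INR_IZR_INZ, Z2Nat.id; auto).
rewrite Hk in *.
set (k := Z.to_nat z) in *.
(* By [Hmax] the fraction [k / d] is below 1/2. *)
assert (Hkd : (k <= d)%nat) by (apply INR_le; nra).
destruct Hpair as [Hpair | Hpair]; pose proof Hpair as (_ & _ & Hlt & _).
- rewrite Rmin_left, Rmax_right in Hbd by lra.
  apply (farey_pair_no_small_denominator n p q r s k d); auto; lia.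
- rewrite Rmin_right, Rmax_left in Hbd by lra.
  apply (farey_pair_no_small_denominator n r s p q k d); auto; lia.
Qed.
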